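(* Let $1\le a<b\le\infty$, $\psi\in\Psi(a,b)$, and $G=G(\psi;a,b)$ over $(X,\mu)$ in the one-dimensional case $d=1$. Then the Shimogaki indices of $G$ satisfy $$\frac1b=\beta^-(G(\psi;a,b))<\beta^+(G(\psi;a,b))=\frac1a$$ (with $1/b=0$ if $b=\infty$).
   Context: Setting. $X=\mathbb{R}_+=[0,\infty)$ with the Borel $\sigma$-algebra and the measure $\mu(V)=\int_V W(x)\,dx$, where $W$ is nontrivial (not identically zero), nonnegative, continuous on $X\setminus\{0\}$ and homogeneous of some order $\theta\in\mathbb{R}$: $W(\lambda x)=\lambda^{\theta}W(x)$ for all $\lambda>0$. Classes of functions. $E\Psi(a,b)$ is the set of continuous functions $\psi:(a,b)\to[1,\infty)$ such that the limits $\psi(a+0)$ and $\psi(b-0)$ exist (possibly infinite) and $\psi(b-0)=\infty$. $\Psi(a,b)$ is the subset of those $\psi\in E\Psi(a,b)$ having a representation: there is a measurable $f:X\to\mathbb{R}$ with $f\in\bigcap_{p\in(a,b)}L_p(X,\mu)$ and $\psi(p)=|f|_p$ for all $p\in(a,b)$, where $|f|_p=\left(\int_X|f|^p\,d\mu\right)^{1/p}$. Bilateral Grand Lebesgue space. $G(\psi;a,b)$ is the space of measurable $h:X\to\mathbb{R}$ (modulo a.e. equality) with $\|h\|G(\psi)=\sup_{p\in(a,b)}|h|_p/\psi(p)<\infty$. Fundamental function. For a rearrangement invariant space $G$, $\phi(\delta)=\phi(G,\delta)=\|I(A)\|G$ for any measurable $A$ with $\mu(A)=\delta$ ($I(A)$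 is the indicator function of $A$); for $G=G(\psi;a,b)$ this is $\phi(\delta)=\sup_{p\in(a,b)}\delta^{1/p}/\psi(p)$. Shimogaki indices. Put $M_G(t)=\sup_{s>0}\phi(st)/\phi(s)$ and $$\beta^-(G)=\sup_{t\in(0,1)}\frac{\log M_G(t)}{\log t}=\lim_{t\to0+}\frac{\log M_G(t)}{\log t},\qquad \beta^+(G)=\inf_{t\in(1,\infty)}\frac{\log M_G(t)}{\log t}=\lim_{t\to\infty}\frac{\log M_G(t)}{\log t}.$$ *)

(* Defs.v *)
From HB Require Import structures.
From mathcomp Require Import all_boot all_order all_algebra.
From mathcomp Require Import all_classical all_reals all_analysis.
From mathcomp Require Import measurable_realfun.

Set Implicit Arguments.
Unset Strict Implicit.
Unset Printing Implicit Defensive.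

Import Order.TTheory GRing.Theory Num.Theory.
Import numFieldNormedType.Exports.

Local Open Scope classical_set_scope.
Local Open Scope ring_scope.

(* The space X = [0, +oo[, with the trace of the Borel sigma-algebra of R. *)
Definition Rplus (R : realType) : Type := {x : R | 0 <= x}.

Definition Rplus_val (R : realType) (x : Rplus R) : R := sval x.

HB.instance Definition _ (R : realType) := Choice.on (Rplus R).
HB.instance Definition _ (R : realType) :=
  isPointed.Build (Rplus R) (exist _ (0 : R) (lexx 0)).
HB.instance Definition _ (R : realType) :=
  Measurable.copy (Rplus R) (g_sigma_algebra_preimageType (@Rplus_val R)).

(* [W] is given as a function on R of which only the values on [0, +oo[ matter.
   Continuity and homogeneity are required away from the origin only, and so
   nontriviality is too: a function vanishing on ]0, +oo[ would induce the zero
   measure whatever its value at 0. *)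
Record homogeneous_weight (R : realType) (theta : R) (W : R -> R) : Prop := {
  weight_ge0 : forall x, 0 <= x -> 0 <= W x ;
  weight_continuous : {in `]0, +oo[, continuous W} ;
  weight_homogeneous : forall lambda x, 0 < lambda -> 0 < x ->
    W (lambda * x) = lambda `^ theta * W x ;
  weight_nontrivial : exists2 x, 0 < x & W x != 0 }.

(* The proof argument is only there to register the set function as a measure. *)
Definition weight_measure (R : realType) (theta : R) (W : R -> R)
    (hW : homogeneous_weight theta W) (V : set (Rplus R)) : \bar R :=
  (\int[lebesgue_measure]_(x in @Rplus_val R @` V) (W x)%:E)%E.

Section weight_measure_is_measure.
Context (R : realType) (theta : R) (W : R -> R).
Variable hW : homogeneous_weight theta W.
Local Open Scope ereal_scope.

Let mu := weight_measure hW.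

Let measurable_image (V : set (Rplus R)) : measurable V ->
  measurable (@Rplus_val R @` V : set R).
Proof.
case=> B mB <-; rewrite setTI.
suff -> : @Rplus_val R @` (@Rplus_val R @^-1` B) = B `&` `[0%R, +oo[%classic.
  exact: measurableI.
apply/seteqP; split=> [_ [[x x0] Bx <-]|x [Bx]] /=.
  by rewrite in_itv/= andbT.
by rewrite in_itv/= andbT => x0; exists (exist _ x x0).
Qed.

Let image_sub (V : set (Rplus R)) : @Rplus_val R @` V `<=` `[0%R, +oo[.
Proof. by move=> _ [[x x0] _ <-]; rewrite /= in_itv/= andbT. Qed.

Let measurable_weight : measurable_fun (`[0%R, +oo[%classic : set R) W.
Proof.
rewrite -(@setU1itv _ _ _ _ false); last by rewrite bnd_simp.
apply/measurable_funU => //; split; first exact: measurable_fun_set1.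
apply: subspace_continuous_measurable_fun => //.
apply: continuous_in_subspaceT => x; rewrite inE.
exact: (weight_continuous hW).
Qed.

Let weight_ge0E (x : R) : (`[0%R, +oo[%classic : set R) x -> 0 <= (EFin \o W) x.
Proof.
by rewrite /= in_itv/= andbT lee_fin => x0; exact: (weight_ge0 hW).
Qed.

Let mu0 : mu set0 = 0.
Proof. by rewrite /mu /weight_measure image_set0 integral_set0. Qed.

Let mu_ge0 V : 0 <= mu V.
Proof. by apply: integral_ge0 => x /image_sub; exact: weight_ge0E. Qed.

Let mu_sigma_additive : semi_sigma_additive mu.
Proof.
move=> F mF tF mUF.
rewrite /mu /weight_measure image_bigcup ge0_integral_bigcup//=.
- by apply: is_cvg_nneseries_cond => n _ _; exact: mu_ge0.
- by move=> n; exact: measurable_image.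
- apply/measurable_EFinP; apply: measurable_funS measurable_weight => //.
  by apply: bigcup_sub => n _; exact: image_sub.
- by move=> x [n _ /image_sub]; exact: weight_ge0E.
- apply/trivIsetP => i j _ _ ij; rewrite -subset0 => _ [[x Fx <-]] [y Fy xy].
  have xyE : y = x by exact/val_inj/xy.
  move/trivIsetP : tF => /(_ i j Logic.I Logic.I ij); rewrite -subset0.
  by apply; split; [exact: Fx|rewrite -xyE; exact: Fy].
Qed.

HB.instance Definition _ := isMeasure.Build _ _ _ mu mu0 mu_ge0 mu_sigma_additive.

End weight_measure_is_measure.

(* The open interval ]a, b[ of real exponents; b = +oo is allowed. *)
Definition exponents (R : realType) (a : R) (b : \bar R) : set R :=
  [set p | a < p /\ (p%:E < b)%E].

(* The filter of the limit p -> b - 0; the case b = -oo is junk. *)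
Definition ereal_at_left (R : realType) (b : \bar R) : set_system R :=
  if b is r%:E then at_left r else pinfty_nbhs R.

Record EPsi (R : realType) (a : R) (b : \bar R) (psi : R -> R) : Prop := {
  EPsi_continuous : {in exponents a b, continuous psi} ;
  EPsi_ge1 : {in exponents a b, forall p, 1 <= psi p} ;
  EPsi_cvg_left_end : cvg ((psi p)%:E @[p --> at_right a]) ;
  EPsi_cvg_right_end : psi p @[p --> ereal_at_left b] --> +oo }.

Section grand_Lebesgue.
Context d (X : measurableType d) (R : realType).
Variable mu : {measure set X -> \bar R}.

Definition Psi (a : R) (b : \bar R) (psi : R -> R) : Prop :=
  EPsi a b psi /\
  exists f : X -> R,
    [/\ measurable_fun setT f,
        {in exponents a b, forall p, f \in Lfun mu p%:E} &
        {in exponents a b, forall p, (psi p)%:E = 'N[mu]_p%:E[EFin \o f]%E}].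

(* The norm of G(psi; a, b); the space consists of the (classes of) measurable
   functions for which this extended real number is finite. *)
Definition grand_norm (a : R) (b : \bar R) (psi : R -> R) (h : X -> R) : \bar R :=
  ereal_sup [set ('N[mu]_p%:E[EFin \o h] / (psi p)%:E)%E | p in exponents a b].

(* A function space is represented by its norm, extended by +oo outside of the
   space. The norm being rearrangement invariant, [N \1_A] depends on
   [mu A] only; the supremum selects this common value. *)
Definition fundamental_function (N : (X -> R) -> \bar R) (delta : R) : \bar R :=
  ereal_sup [set N \1_A | A in [set A | measurable A /\ mu A = delta%:E]].

Definition dilation_function (N : (X -> R) -> \bar R) (t : R) : \bar R :=
  ereal_sup [set (fundamental_function N (s * t) / fundamental_function N s)%E
            | s in `]0, +oo[].

(* These are the sup and inf forms of the indices; they coincide with the limits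
   at 0+ and +oo by submultiplicativity of the dilation function. *)
Definition Shimogaki_lower (N : (X -> R) -> \bar R) : \bar R :=
  ereal_sup [set (lne (dilation_function N t) / (ln t)%:E)%E | t in `]0, 1[].

Definition Shimogaki_upper (N : (X -> R) -> \bar R) : \bar R :=
  ereal_inf [set (lne (dilation_function N t) / (ln t)%:E)%E | t in `]1, +oo[].

End grand_Lebesgue.

(* Main.v *)
Require Import Defs.
From mathcomp Require Import all_boot all_order all_algebra.
From mathcomp Require Import all_classical all_reals all_analysis.
Import Order.TTheory GRing.Theory Num.Theory.
Import numFieldNormedType.Exports.
Local Open Scope classical_set_scope.
Local Open Scope ring_scope.

(** Since |I(A)|_p = mu(A) ^ (1 / p), the substitution q = 1 / p turns the
fundamental function into phi(s) = sup_q s ^ q w(q), where q ranges over the open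
interval ]1/b, 1/a[ and w(q) = 1 / psi(1 / q) lies in ]0, 1]
([fundamental_function_grand_norm]). Let M(t) = sup_s phi(s t) / phi(s).

For t > 1 each term s ^ q w(q) grows by t ^ q < t ^ (1/a) when s becomes s t, so
M(t) <= t ^ (1/a). Conversely, for large s only the exponents close to 1/a matter
in the supremum, since w is bounded by 1 and a larger exponent eventually wins
over any constant ([power_sup_dilation_ge]); hence M(t) >= t ^ c for each
c < 1/a. Thus M(t) = t ^ (1/a) exactly ([sup_quotient_power_sup]). The inversion
s |-> 1 / s exchanges the two ends of the interval and gives M(t) = t ^ (1/b) for
t < 1 ([sup_quotient_power_sup_lt1]). The quotients log M(t) / log t are therefore
constant on either side of 1, equal to 1/b and 1/a
([Shimogaki_indices_grand_norm]).

What remains is that phi(s) is the norm of an actual indicator for every s > 0: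
the weighted measure takes every positive finite value
([weight_measure_surjective]), because a homogeneous weight is a multiple of a
power, the integral of which over ]0, +oo[ diverges at one end at least. *)

Set Implicit Arguments.
Unset Strict Implicit.
Unset Printing Implicit Defensive.

(** * Suprema of weighted powers *)

Definition power_sup (R : realType) (D : set R) (w : R -> R) (s : R) : R :=
  sup [set s `^ q * w q | q in D].

Definition sup_quotient (R : realType) (phi : R -> R) (t : R) : \bar R :=
  ereal_sup [set (phi (s * t) / phi s)%:E | s in `]0, +oo[].

Section power_sup_open_interval.
Context (R : realType) (beta alpha : R) (w : R -> R).
Context (ltba : beta < alpha).
Context (w01 : {in `]beta, alpha[, forall q, 0 < w q <= 1}).

Local Notation P := (power_sup `]beta, alpha[ w).

Lemma power_sup_has_ubound s : 0 < s ->
  has_ubound [set s `^ q * w q | q in `]beta, alpha[].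
Proof.
(* for q in the interval, s `^ q lies between s `^ alpha and s `^ beta *)
move=> s0; exists (s `^ alpha + s `^ beta) => _ [q qD <-].
have /andP[_ w1] := w01 qD; move: qD; rewrite /= in_itv/= => /andP[bq qa].
apply: (@le_trans _ _ (s `^ q)); first by rewrite ler_piMr// powR_ge0.
have [s1|s1] := leP 1 s.
  by rewrite (le_trans (ler_powR s1 (ltW qa)))// lerDl powR_ge0.
rewrite (le_trans (ger_powR _ (ltW bq))) ?lerDr ?powR_ge0//.
by rewrite s0 ltW.
Qed.

Lemma power_sup_ge s q : 0 < s -> q \in `]beta, alpha[ -> s `^ q * w q <= P s.
Proof.
by move=> s0 qD; apply: ub_le_sup; [exact: power_sup_has_ubound|exists q].
Qed.

Lemma power_sup_nonempty s : [set s `^ q * w q | q in `]beta, alpha[] !=set0.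
Proof.
by eexists; exists ((beta + alpha) / 2) => //=; rewrite in_itv/= !midf_lt.
Qed.

Lemma power_sup_gt0 s : 0 < s -> 0 < P s.
Proof.
move=> s0; have [_ [q qD _]] := power_sup_nonempty s.
apply: lt_le_trans (power_sup_ge s0 qD).
by rewrite mulr_gt0 ?powR_gt0//; have /andP[] := w01 qD.
Qed.

Lemma power_sup_dilation_le s t : 0 < s -> 1 <= t -> P (s * t) <= t `^ alpha * P s.
Proof.
move=> s0 t1; have t0 : 0 < t by exact: lt_le_trans t1.
apply: ge_sup; first exact: power_sup_nonempty.
move=> _ [q qD <-]; rewrite powRM ?(ltW s0) ?(ltW t0)// (mulrC (s `^ q)) -mulrA.
apply: ler_pM; rewrite ?powR_ge0//.
- by rewrite mulr_ge0 ?powR_ge0//; have /andP[/ltW] := w01 qD.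
- by apply: ler_powR => //; move: qD; rewrite /= in_itv/= => /andP[_ /ltW].
- exact: power_sup_ge.
Qed.

(** For large s the exponents near alpha dominate the supremum: since w <= 1, an
exponent q < c contributes at most s ^ c, and as soon as s ^ (d - c) >= 1 / w d
for some d in ]c, alpha[ the exponent d alone contributes as much. So P s is
governed by exponents >= c, each of which gains a factor >= t ^ c when s is
replaced by s * t. *)
Lemma power_sup_dilation_ge c t : c \in `]beta, alpha[ -> 1 <= t ->
  exists2 s, 0 < s & t `^ c * P s <= P (s * t).
Proof.
move=> cD t1; have t0 : 0 < t by exact: lt_le_trans t1.
have /andP[bc ca] : beta < c < alpha by move: cD; rewrite in_itv.
pose d := (c + alpha) / 2.
have cd : c < d by rewrite midf_lt.
have dD : d \in `]beta, alpha[ by rewrite in_itv/= (lt_trans bc)//= midf_lt.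
have /andP[wd0 wd1] := w01 dD.
(* the value of s at which s `^ c = s `^ d * w d *)
pose s := (w d) `^ (- (d - c)^-1).
have s0 : 0 < s by rewrite powR_gt0.
have s1 : 1 <= s.
  rewrite /s powRN invf_ge1 ?powR_gt0// -(powRr0 (w d)).
  apply: ger_powR; first by rewrite wd0.
  by rewrite invr_ge0 subr_ge0 ltW.
have scd : s `^ c = s `^ d * w d.
  have -> : w d = s `^ (c - d).
    rewrite /s -powRrM -(opprB d c) mulrN mulNr opprK mulVf ?powRr1 ?ltW//.
    by rewrite gt_eqF// subr_gt0.
  by rewrite -powRD ?(gt_eqF s0) ?implybT// addrC subrK.
exists s => //; rewrite mulrC -ler_pdivlMr ?powR_gt0//.
apply: ge_sup; first exact: power_sup_nonempty.
move=> _ [q qD <-]; rewrite ler_pdivlMr ?powR_gt0//.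
have /andP[wq0 wq1] := w01 qD.
have st0 : 0 < s * t by rewrite mulr_gt0.
have [cq|qc] := leP c q.
  apply: le_trans (power_sup_ge st0 qD).
  rewrite powRM ?(ltW s0) ?(ltW t0)// mulrAC ler_pM2r// ler_pM2l ?powR_gt0//.
  exact: ler_powR.
apply: le_trans (power_sup_ge st0 dD).
rewrite powRM ?(ltW s0) ?(ltW t0)// [leRHS]mulrAC -scd; apply: ler_pM; rewrite ?powR_ge0//.
- by rewrite mulr_ge0 ?powR_ge0// ltW.
- apply: (@le_trans _ _ (s `^ q)); first by rewrite ler_piMr// powR_ge0.
  by apply: ler_powR => //; exact: ltW.
- by apply: ler_powR => //; exact: ltW.
Qed.

(** Replacing s by s * t multiplies each s ^ q by t ^ q < t ^ alpha, whence the
upper bound; it is approached as s grows, because the exponents that matter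
then tend to alpha. *)
Lemma sup_quotient_power_sup t : 1 < t -> sup_quotient P t = (t `^ alpha)%:E.
Proof.
move=> t1; have t0 : 0 < t by exact: lt_trans t1.
apply/eqP; rewrite eq_le; apply/andP; split.
  apply: ge_ereal_sup => _ [s + <-]; rewrite /= in_itv/= andbT => s0.
  by rewrite lee_fin ler_pdivrMr ?power_sup_gt0// power_sup_dilation_le// ltW.
rewrite leNgt; apply/negP.
have le_quot c : c \in `]beta, alpha[ ->
    ((t `^ c)%:E <= sup_quotient P t)%E.
  move=> cD; have [s s0 sc] := power_sup_dilation_ge cD (ltW t1).
  apply: (@le_trans _ _ (P (s * t) / P s)%:E).
    by rewrite lee_fin ler_pdivlMr// power_sup_gt0.
  by apply: ereal_sup_ubound; exists s => //=; rewrite in_itv/= s0.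
case: (sup_quotient P t) le_quot => [x| |] le_quot //; last first.
  by have [_ [q qD _]] := power_sup_nonempty t; have := le_quot _ qD.
rewrite lte_fin => xa.
have x0 : 0 < x.
  have [_ [q qD _]] := power_sup_nonempty t.
  by rewrite (lt_le_trans (powR_gt0 q t0))// -lee_fin; exact: le_quot.
have lnt0 := ln_gt0 t1.
(* the exponent of x in base t would be < alpha, leaving room for an admissible
   exponent above it *)
pose m := Num.max beta (ln x / ln t).
have ma : m < alpha.
  by rewrite gt_max ltba ltr_pdivrMr//= -ln_powR ltr_ln ?posrE// powR_gt0.
have mm : m < (m + alpha) / 2 by rewrite midf_lt.
have cD : (m + alpha) / 2 \in `]beta, alpha[.
  by rewrite in_itv/= midf_lt// andbT (le_lt_trans _ mm)// le_max lexx.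
have := le_quot _ cD; rewrite lee_fin -ler_ln ?posrE ?powR_gt0//.
rewrite ln_powR -ler_pdivlMr// leNgt (le_lt_trans _ mm)//.
by rewrite le_max lexx orbT.
Qed.

End power_sup_open_interval.

(** The inversion s |-> 1 / s reverses the sign of the exponents, so that the
behaviour of the supremum at 0 and for t < 1 reduces to its behaviour at
infinity and for t > 1. *)
Lemma power_sup_inv (R : realType) (beta alpha : R) (w : R -> R) (s : R) :
  0 < s ->
  power_sup `]beta, alpha[ w s^-1 =
  power_sup `]- alpha, - beta[ (w \o -%R) s.
Proof.
move=> s0; congr sup; apply/seteqP; split => _ [q + <-];
  rewrite /= in_itv/= => /andP[q1 q2]; exists (- q) => /=.
- by rewrite in_itv/= !ltrN2 q1 q2.
- by rewrite opprK -powR_inv1 ?ltW// -powRrM mulN1r.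
- by rewrite in_itv/= ltrNr q2 ltrNl q1.
- by rewrite -powR_inv1 ?ltW// -powRrM mulrNN mul1r.
Qed.

Lemma sup_quotient_inv (R : realType) (phi : R -> R) (t : R) :
  sup_quotient (fun s => phi s^-1) t = sup_quotient phi t^-1.
Proof.
congr ereal_sup; apply/seteqP; split => _ [s + <-];
  rewrite /= in_itv/= andbT => s0; exists s^-1;
  by rewrite /= ?in_itv/= ?invr_gt0 ?s0 ?invfM ?invrK.
Qed.

Lemma sup_quotient_power_sup_lt1 (R : realType) (beta alpha : R) (w : R -> R)
    (t : R) : beta < alpha -> {in `]beta, alpha[, forall q, 0 < w q <= 1} ->
  0 < t < 1 -> sup_quotient (power_sup `]beta, alpha[ w) t = (t `^ beta)%:E.
Proof.
move=> ltba w01 /andP[t0 t1].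
rewrite -[t in LHS]invrK -sup_quotient_inv.
transitivity
    (sup_quotient (power_sup `]- alpha, - beta[ (w \o -%R)) t^-1).
  congr ereal_sup; apply/seteqP; split => _ [s + <-];
    rewrite /= in_itv/= andbT => s0; exists s;
    by rewrite /= ?in_itv/= ?s0// !power_sup_inv// mulr_gt0 ?invr_gt0.
rewrite sup_quotient_power_sup.
- by rewrite -powR_inv1 ?(ltW t0)// -powRrM mulrNN mul1r.
- by rewrite ltrN2.
- move=> q /=; rewrite in_itv/= => /andP[q1 q2]; apply: w01.
  by rewrite in_itv/= ltrNr q2 ltrNl q1.
- by rewrite invf_gt1.
Qed.

(** * Fundamental function and indices of a grand Lebesgue space *)

(** In the variable q = 1 / p the exponents form a bounded interval even for
b = +oo, where fine b^-1 is 0. *)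
Lemma exponents_inv (R : realType) (a : R) (b : \bar R) (p : R) :
  0 < a -> (a%:E < b)%E ->
  exponents a b p <-> p^-1 \in `](fine b^-1), a^-1[.
Proof.
move=> a0; rewrite /exponents in_itv/=; case: b => [b| |] //.
  rewrite lte_fin => ab; have b0 : 0 < b by exact: lt_trans ab.
  rewrite fine_invr; split => [[ap]|/andP[bp pa]].
    rewrite lte_fin => pb; have p0 : 0 < p by exact: lt_trans ap.
    by rewrite !ltf_pV2 ?posrE// ap pb.
  have p0 : 0 < p by rewrite -invr_gt0 (lt_trans _ bp)// invr_gt0.
  by rewrite lte_fin -[p < b]ltf_pV2 ?posrE// -[a < p]ltf_pV2 ?posrE.
move=> _; split=> [[ap _]|/andP[]]; rewrite /= invr_gt0.
  by rewrite (lt_trans a0 ap) ltf_pV2 ?posrE// (lt_trans a0 ap).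
by move=> p0; rewrite ltf_pV2 ?posrE// => ap; rewrite ltry.
Qed.

Lemma fine_inve_lt (R : realType) (a : R) (b : \bar R) :
  0 < a -> (a%:E < b)%E -> fine b^-1 < a^-1.
Proof.
move=> a0; case: b => [b| |] //; rewrite /= ?invr_gt0//.
rewrite lte_fin => ab; have b0 : 0 < b by exact: lt_trans ab.
by rewrite fine_invr ltf_pV2.
Qed.

Lemma inve_fineK (R : realType) (a : R) (b : \bar R) :
  0 < a -> (a%:E < b)%E -> (b^-1)%E = (fine b^-1)%:E.
Proof.
move=> a0; case: b => [b| |] //; rewrite lte_fin => ab.
by rewrite inver gt_eqF// (lt_trans a0).
Qed.

Lemma exponents_inv_weight (R : realType) (a : R) (b : \bar R) (psi : R -> R) :
  0 < a -> (a%:E < b)%E -> {in exponents a b, forall p, 1 <= psi p} ->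
  {in `](fine b^-1), a^-1[, forall q, 0 < (psi q^-1)^-1 <= 1}.
Proof.
move=> a0 ab psi1 q qD.
have pe : exponents a b q^-1 by apply/exponents_inv => //; rewrite invrK.
have := psi1 _ (mem_set pe) => psi1q.
by rewrite invr_gt0 (lt_le_trans ltr01)//= invf_le1// (lt_le_trans ltr01).
Qed.

Section grand_norm_indices.
Context d (X : measurableType d) (R : realType) (mu : {measure set X -> \bar R}).

Lemma Lnorm_indic (p delta : R) (A : set X) : 0 < p -> measurable A ->
  mu A = delta%:E -> ('N[mu]_p%:E[EFin \o \1_A] = (delta `^ p^-1)%:E)%E.
Proof.
move=> p0 mA muA; rewrite unlock.
under eq_integral => x _.
  rewrite /= (_ : `|\1_A x| `^ p = \1_A x); last first.
    rewrite indicE; case: (x \in A); first by rewrite normr1 powR1.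
    by rewrite normr0 powR0// gt_eqF.
  over.
by rewrite integral_indic// setIT muA.
Qed.

(** Since |I(A)|_p = delta ^ (1 / p) for every A of measure delta, all these sets
have the same norm, which is a supremum of weighted powers of delta in the
variable q = 1 / p. A set of measure delta must exist, for otherwise the
supremum defining the fundamental function would be -oo. *)
Lemma fundamental_function_grand_norm (a : R) (b : \bar R) (psi : R -> R)
    (delta : R) :
  0 < a -> (a%:E < b)%E -> {in exponents a b, forall p, 1 <= psi p} ->
  0 < delta -> (exists2 A, measurable A & mu A = delta%:E) ->
  fundamental_function mu (grand_norm mu a b psi) delta =
  (power_sup `](fine b^-1), a^-1[ (fun q => (psi q^-1)^-1) delta)%:E.
Proof.
move=> a0 ab psi1 delta0 [A mA muA].
have norm_indic B : measurable B -> mu B = delta%:E ->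
    grand_norm mu a b psi \1_B =
    (power_sup `](fine b^-1), a^-1[ (fun q => (psi q^-1)^-1) delta)%:E.
  move=> mB muB; rewrite -ereal_sup_EFin; last 2 first.
  - exact: power_sup_has_ubound (exponents_inv_weight a0 ab psi1) _ delta0.
  - exact/power_sup_nonempty/fine_inve_lt.
  have normE p : exponents a b p ->
      ('N[mu]_p%:E[EFin \o \1_B] / (psi p)%:E =
       (delta `^ p^-1 * (psi p)^-1)%:E)%E.
    move=> pe; have p0 : 0 < p by case: pe => ap _; exact: lt_trans ap.
    rewrite (Lnorm_indic p0 mB muB) inver gt_eqF//.
    by rewrite (lt_le_trans ltr01)// psi1// inE.
  congr ereal_sup; rewrite image_comp; apply/seteqP; split => _ [p pe <-].
    by exists p^-1; [exact/exponents_inv|rewrite /= invrK normE].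
  have pe' : exponents a b p^-1 by apply/exponents_inv => //; rewrite invrK.
  by exists p^-1 => //; rewrite normE//= invrK.
rewrite /fundamental_function -[RHS]ereal_sup1; congr ereal_sup.
apply/seteqP; split => [_ [B [mB muB] <-]|_ ->]; first exact: norm_indic.
by exists A => //; exact: norm_indic.
Qed.

Lemma dilation_function_grand_norm (a : R) (b : \bar R) (psi : R -> R) (t : R) :
  0 < a -> (a%:E < b)%E -> {in exponents a b, forall p, 1 <= psi p} ->
  (forall delta, 0 < delta -> exists2 A, measurable A & mu A = delta%:E) ->
  0 < t ->
  dilation_function mu (grand_norm mu a b psi) t =
  sup_quotient
    (power_sup `](fine b^-1), a^-1[ (fun q => (psi q^-1)^-1)) t.
Proof.
move=> a0 ab psi1 muS t0; set P := power_sup _ _.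
have w01 := exponents_inv_weight a0 ab psi1.
have fundE s : 0 < s ->
    fundamental_function mu (grand_norm mu a b psi) s = (P s)%:E.
  by move=> s0; apply: fundamental_function_grand_norm => //; exact: muS.
have quotE s : 0 < s ->
    (fundamental_function mu (grand_norm mu a b psi) (s * t) /
     fundamental_function mu (grand_norm mu a b psi) s)%E =
    (P (s * t) / P s)%:E.
  move=> s0; rewrite !fundE ?mulr_gt0// inver gt_eqF//.
  by apply: power_sup_gt0 => //; exact: fine_inve_lt.
by congr ereal_sup; apply/seteqP; split => _ [s s0 <-]; exists s => //;
  rewrite quotE//; move: s0; rewrite /= in_itv/= andbT.
Qed.

(** As the dilation function is exactly t ^ (1 / b) for t < 1 and t ^ (1 / a) for
t > 1, the quotients of logarithms are constant on either side of 1. *)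
Lemma Shimogaki_indices_grand_norm (a : R) (b : \bar R) (psi : R -> R) :
  0 < a -> (a%:E < b)%E -> {in exponents a b, forall p, 1 <= psi p} ->
  (forall delta, 0 < delta -> exists2 A, measurable A & mu A = delta%:E) ->
  Shimogaki_lower mu (grand_norm mu a b psi) = (b^-1)%E /\
  Shimogaki_upper mu (grand_norm mu a b psi) = (a^-1)%:E.
Proof.
move=> a0 ab psi1 muS.
have w01 := exponents_inv_weight a0 ab psi1.
have ltba := fine_inve_lt a0 ab.
have lneE (t c : R) : 0 < t -> ln t != 0 ->
    (lne (t `^ c)%:E / (ln t)%:E)%E = c%:E.
  move=> t0 lnt; rewrite lne_EFin ?powR_gt0// ln_powR inver (negbTE lnt).
  by rewrite -EFinM mulfK.
split.
  rewrite (inve_fineK a0 ab) -[RHS]ereal_sup1; congr ereal_sup.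
  have lower t : 0 < t < 1 ->
      (lne (dilation_function mu (grand_norm mu a b psi) t) / (ln t)%:E)%E =
      (fine b^-1)%:E.
    move=> t01; have /andP[t0 t1] := t01.
    rewrite dilation_function_grand_norm// sup_quotient_power_sup_lt1//.
    by rewrite lneE// lt_eqF// ln_lt0.
  apply/seteqP; split=> [_ [t + <-]|_ ->].
    by rewrite /= in_itv; exact: lower.
  have half01 : 0 < (2^-1 : R) < 1 by rewrite invr_gt0 invf_lt1 ?ltr0n ?ltr1n.
  by exists 2^-1; rewrite /= ?in_itv//=; exact: lower.
rewrite /Shimogaki_upper -[RHS]ereal_inf1; congr ereal_inf.
have upper t : 1 < t ->
    (lne (dilation_function mu (grand_norm mu a b psi) t) / (ln t)%:E)%E =
    (a^-1)%:E.
  move=> t1; have t0 : 0 < t by exact: lt_trans t1.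
  rewrite dilation_function_grand_norm// sup_quotient_power_sup//.
  by rewrite lneE// gt_eqF// ln_gt0.
apply/seteqP; split=> [_ [t + <-]|_ ->].
  by rewrite /= in_itv/= andbT; exact: upper.
by exists 2; rewrite /= ?in_itv/= ?ltr1n//; apply: upper; rewrite ltr1n.
Qed.

End grand_norm_indices.

(** * Values of the weighted measure *)

Section homogeneous_weight_measure.
Context (R : realType) (theta : R) (W : R -> R).
Context (hW : homogeneous_weight theta W).

Lemma homogeneous_weightE x : 0 < x -> W x = W 1 * x `^ theta.
Proof.
by move=> x0; rewrite mulrC -(weight_homogeneous hW) ?mulr1.
Qed.

Lemma homogeneous_weight1_gt0 : 0 < W 1.
Proof.
rewrite lt_neqAle (weight_ge0 hW) ?ler01// andbT eq_sym.
have [x x0] := weight_nontrivial hW.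
by rewrite homogeneous_weightE// mulf_eq0 negb_or => /andP[].
Qed.

Lemma weight_measure_itv (F : R -> R) (x y : R) : 0 < x -> x < y ->
  (forall z : R, 0 < z -> is_derive z 1 F (W z)) ->
  exists2 A, measurable A & weight_measure hW A = (F y - F x)%:E.
Proof.
move=> x0 xy dF.
have cvF (z : R) : 0 < z -> F z' @[z' --> z] --> F z.
  move=> /dF[dFz _].
  by have /derivable1_diffP/differentiable_continuous := dFz.
exists (@Rplus_val R @^-1` `[x, y]).
  by exists `[x, y]%classic; [exact: measurable_itv|rewrite setTI].
rewrite /weight_measure.
have -> : @Rplus_val R @` (@Rplus_val R @^-1` `[x, y]) = `[x, y]%classic.
  apply/seteqP; split => [_ [z zxy <-] //|z zxy].
  have z0 : 0 <= z.
    by move: zxy; rewrite /= in_itv/= => /andP[xz _]; rewrite (le_trans (ltW x0)).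
  by exists (exist _ z z0).
have y0 := lt_trans x0 xy.
rewrite (continuous_FTC2 xy (F := F)) ?EFinB//.
- apply: continuous_in_subspaceT => z; rewrite inE/= in_itv/= => /andP[xz _].
  by apply: (weight_continuous hW); rewrite in_itv/= andbT (lt_le_trans x0).
- split; [|exact/cvg_at_right_filter/cvF|exact/cvg_at_left_filter/cvF].
  move=> z; rewrite in_itv/= => /andP[xz _].
  by have [] := dF z (lt_trans x0 xz).
- move=> z; rewrite in_itv/= => /andP[xz _].
  by rewrite derive1E; have [] := dF z (lt_trans x0 xz).
Qed.

(** By homogeneity W is W 1 * x ^ theta on ]0, +oo[, with primitive
W 1 * x ^ c / c for c = theta + 1 != 0 and W 1 * ln x for c = 0. Whatever theta,
this primitive is unbounded at 0 or at +oo, so an interval with one end at 1,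
extending towards +oo if c >= 0 and towards 0 if c < 0, can be given any positive
measure. *)
Lemma weight_measure_surjective delta : 0 < delta ->
  exists2 A, measurable A & weight_measure hW A = delta%:E.
Proof.
move=> delta0; have W10 := homogeneous_weight1_gt0.
pose c := theta + 1.
have [c0|c0] := eqVneq c 0.
  have dF (z : R) : 0 < z -> is_derive z 1 (fun u => W 1 * ln u) (W z).
    move=> z0; have := is_derive1_ln z0 => dln.
    apply: is_derive_eq; rewrite (homogeneous_weightE z0).
    have -> : theta = -1 by apply/eqP; rewrite -addr_eq0 -/c c0.
    by rewrite powR_inv1 ?(ltW z0).
  have lt1 : 1 < expR (delta / W 1) by rewrite expR_gt1 divr_gt0.
  have [A mA muA] := weight_measure_itv ltr01 lt1 dF.
  by exists A; rewrite // muA expRK ln1 mulr0 subr0 mulrC divfK// gt_eqF.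
have dF (z : R) : 0 < z -> is_derive z 1 (fun u => W 1 / c * u `^ c) (W z).
  move=> z0; have := is_derive1_powR c z0 => dpow.
  apply: is_derive_eq; rewrite (homogeneous_weightE z0) addrK.
  by rewrite -[LHS]/(W 1 / c * (c * z `^ theta)) mulrA divfK.
pose k := delta * `|c| / W 1.
have k0 : 0 < k by rewrite divr_gt0 ?mulr_gt0 ?normr_gt0.
(* the endpoint for which |u `^ c - 1| * W 1 / |c| is delta *)
pose u := (1 + k) `^ c^-1.
have u0 : 0 < u by rewrite powR_gt0// addr_gt0.
have ucE : u `^ c = 1 + k by rewrite -powRrM mulVf// powRr1// addr_ge0 ?ltW.
have kE : W 1 * k = delta * `|c| by rewrite mulrC divfK// gt_eqF.
have lnk0 : 0 < ln (1 + k) by rewrite ln_gt0// ltrDl.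
have [cgt|clt|cE] := ltgtP 0 c; last by rewrite cE eqxx in c0.
  have lt1 : 1 < u.
    by rewrite -ltr_ln ?posrE// ln1 ln_powR pmulr_rgt0 ?invr_gt0.
  have [A mA muA] := weight_measure_itv ltr01 lt1 dF.
  exists A; rewrite // muA ucE powR1 -mulrBr addrAC subrr add0r mulrAC kE.
  by rewrite gtr0_norm// mulfK.
have lt1 : u < 1.
  by rewrite -ltr_ln ?posrE// ln1 ln_powR nmulr_rlt0 ?invr_lt0.
have [A mA muA] := weight_measure_itv u0 lt1 dF.
exists A; rewrite // muA ucE powR1 -mulrBr opprD addrA subrr add0r mulrN mulrAC.
by rewrite kE ltr0_norm// mulrN mulNr opprK mulfK.
Qed.

End homogeneous_weight_measure.

(** * Indices over the weighted half-line *)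

Theorem theorem2 (R : realType) (theta : R) (W : R -> R)
    (hW : homogeneous_weight theta W) (a : R) (b : \bar R) (psi : R -> R)
    (ha : 1 <= a) (hab : (a%:E < b)%E)
    (hpsi : Psi (weight_measure hW) a b psi) :
  let mu := weight_measure hW in
  let G := grand_norm mu a b psi in
  [/\ (b^-1)%E = Shimogaki_lower mu G,
      (Shimogaki_lower mu G < Shimogaki_upper mu G)%E &
      Shimogaki_upper mu G = (a^-1)%:E].
Proof.
have a0 : 0 < a by exact: lt_le_trans ha.
have [[_ psi1 _ _] _] := hpsi.
have [lowerE upperE] := Shimogaki_indices_grand_norm a0 hab psi1
  (weight_measure_surjective hW).
move=> mu G; rewrite /G /mu lowerE upperE; split => //.
by rewrite (inve_fineK a0 hab) lte_fin fine_inve_lt.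
Qed.
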